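(* Let $G^0\in\mathcal{S}_G$ satisfy $\Pi_{D_-}G^0=0$, let $\eta\ge0$ be a stepsize, and let $\lambda=0$. Let $\{G^k\}_{k\ge0}$ be generated by $$G^{k+1}=G^k-\eta\,\Pi_{X_-}\nabla J_\lambda(G^k),\qquad k=0,1,2,\dots,$$ where the iterates are assumed to remain in $\mathcal{S}_G$ (so that the update is well defined). Then $\Pi_{D_-}G^k=0$ for all $k\in\{0,1,\dots\}$.
   Context: Setting. Let $A\in\mathbb{R}^{n\times n}$, $B\in\mathbb{R}^{n\times m}$ with $(A,B)$ controllable, and let $Q\in\mathbb{R}^{n\times n}$, $R\in\mathbb{R}^{m\times m}$ be symmetric positive definite. Let $X_-\in\mathbb{R}^{n\times T}$, $U_-\in\mathbb{R}^{m\times T}$, $X_+\in\mathbb{R}^{n\times T}$ be data matrices satisfying $X_+=AX_-+BU_-$, and assume that $D_-=\begin{bmatrix}U_- \\ X_-\end{bmatrix}\in\mathbb{R}^{(m+n)\times T}$ has full row rank $m+n$. For $G\in\mathbb{R}^{T\times n}$ with spectral radius $\rho(X_+G)<1$, let $\Sigma_G$ be the unique solution of $\Sigma_G=I_n+X_+G\Sigma_GG^\top X_+^\top$ and define $J(G)=\mathrm{Tr}\{(Q+G^\top U_-^\top RU_-G)\Sigma_G\}$ and, for $\lambda\ge0$, the certainty-equivalence regularized cost $$J_\lambda(G)=J(G)+\lambda\|\Pi_{D_-}G\Sigma_G^{1/2}\|^2,$$ so that $J_0=J$. Gradients are those of functions on the open set $\{G\in\mathbb{R}^{T\times n}:\rho(X_+G)<1\}$.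 Feasible set: $\mathcal{S}_G=\{G\in\mathbb{R}^{T\times n}: X_-G=I_n,\ \rho(X_+G)<1\}$. Projections: $\Pi_{X_-}=I_T-X_-^\dagger X_-$ and $\Pi_{D_-}=I_T-D_-^\dagger D_-$, where for a full row rank matrix $M$, $M^\dagger=M^\top(MM^\top)^{-1}$; these are the orthogonal projections onto the nullspaces of $X_-$ and $D_-$. *)

(* Defs.v *)
From mathcomp Require Import all_boot all_order all_algebra complex.
From mathcomp Require Import all_classical all_reals all_analysis.

Set Implicit Arguments.
Unset Strict Implicit.
Unset Printing Implicit Defensive.

Import Order.TTheory GRing.Theory Num.Theory.
Import numFieldNormedType.Exports.

Local Open Scope classical_set_scope.
Local Open Scope ring_scope.

Definition posdefmx (R : realType) (n : nat) (M : 'M[R]_n) : Prop :=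
  M \is symmetricmx /\
  forall x : 'cV[R]_n, x != 0 -> 0 < (x^T *m M *m x) 0 0.

Definition possemidefmx (R : realType) (n : nat) (M : 'M[R]_n) : Prop :=
  M \is symmetricmx /\
  forall x : 'cV[R]_n, 0 <= (x^T *m M *m x) 0 0.

(* Kalman's criterion: [B  A B  ...  A^(n-1) B] has rank n. *)
Definition controllable (R : realType) (n m : nat)
    (A : 'M[R]_n) (B : 'M[R]_(n, m)) : Prop :=
  row_free (\mxrow_(k < n) (A ^+ k *m B)).

(* The eigenvalues of a real matrix are taken in R[i]. *)
Definition spectral_radius (R : realType) (n : nat) (M : 'M[R]_n) : R :=
  sup [set r | exists2 z : R[i],
                 eigenvalue (map_mx (real_complex R) M) z & r = complex.Re `|z|].

(* The norm `|M| that the library puts on matrices is the largest absolute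
   value of an entry; it serves here only for the topology. *)
Definition frobenius (R : realType) (m n : nat) (M : 'M[R]_(m, n)) : R :=
  Num.sqrt (\sum_i \sum_j M i j ^+ 2).

(* The symmetric positive semidefinite square root of S when S is itself
   symmetric positive semidefinite; 0 otherwise. *)
Definition sqrtmx (R : realType) (n : nat) (S : 'M[R]_n) : 'M[R]_n :=
  xget 0 [set M | possemidefmx M /\ M *m M = S].

(* M^T (M M^T)^-1, the Moore-Penrose inverse of a matrix M of full row rank.
   The library's pinvmx is only some one-sided inverse. *)
Definition right_pinv (R : realType) (m n : nat) (M : 'M[R]_(m, n)) :
    'M[R]_(n, m) :=
  M^T *m invmx (M *m M^T).

Definition null_proj (R : realType) (m n : nat) (M : 'M[R]_(m, n)) : 'M[R]_n :=
  1%:M - right_pinv M *m M.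

(* Gradient for the trace inner product <X, Y> = \tr (X^T *m Y): the matrix of
   partial derivatives, read off the Frechet differential of f at G. *)
Definition gradient (R : realType) (m n : nat) (f : 'M[R]_(m, n) -> R)
    (G : 'M[R]_(m, n)) : 'M[R]_(m, n) :=
  \matrix_(i, j) ('d (f : 'M[R]_(m, n) -> R^o) G) (delta_mx i j).

Section DataDrivenLQR.
Variables (R : realType) (n m T : nat).
Variables (Q : 'M[R]_n) (Rw : 'M[R]_m).
Variables (Um : 'M[R]_(m, T)) (Xm Xp : 'M[R]_(n, T)).
Implicit Type G : 'M[R]_(T, n).

Definition data_matrix : 'M[R]_(m + n, T) := col_mx Um Xm.

(* The solution is unique when spectral_radius (Xp *m G) < 1. No meaning is
   attached to the value elsewhere; since the stable set is open, that value
   does not affect gradients at stable points. *)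
Definition Sigma G : 'M[R]_n :=
  xget 0 [set S | S = 1%:M + Xp *m G *m S *m G^T *m Xp^T].

Definition lqr_cost G : R :=
  \tr ((Q + G^T *m Um^T *m Rw *m Um *m G) *m Sigma G).

Definition lqr_cost_reg (lambda : R) G : R :=
  lqr_cost G
  + lambda * frobenius (null_proj data_matrix *m G *m sqrtmx (Sigma G)) ^+ 2.

Definition feasible G : Prop :=
  Xm *m G = 1%:M /\ spectral_radius (Xp *m G) < 1.

End DataDrivenLQR.

(* Main.v *)
(** The cost depends on [G] only through [D_- G], since
    [X_+ G = B (U_- G) + A (X_- G)]; hence its derivative vanishes along the
    null space of [D_-], i.e. [Pi_{D_-}] annihilates the gradient. As
    [Pi_{D_-} Pi_{X_-} = Pi_{D_-}], a gradient step does not change [Pi_{D_-} G]. *)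

Require Import Defs.
From mathcomp Require Import all_boot all_order all_algebra complex.
From mathcomp Require Import all_classical all_reals all_analysis.

Set Implicit Arguments.
Unset Strict Implicit.
Unset Printing Implicit Defensive.

Import Order.TTheory GRing.Theory Num.Theory.
Import numFieldNormedType.Exports.

Local Open Scope ring_scope.

Lemma trmx_sqr_eq0 (R : realDomainType) (p q : nat) (v : 'M[R]_(p, q)) :
  v *m v^T = 0 -> v = 0.
Proof.
move=> v0; apply/matrixP => i j; rewrite mxE.
have /eqP := congr1 (fun S : 'M[R]_p => S i i) v0.
rewrite !mxE psumr_eq0 => [/allP/(_ j (mem_index_enum _))|k _]; last first.
  by rewrite mxE -expr2 sqr_ge0.
by rewrite mxE mulf_eq0 orbb => /eqP.
Qed.

Lemma gram_unitmx (R : realFieldType) (p q : nat) (M : 'M[R]_(p, q)) :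
  row_free M -> M *m M^T \in unitmx.
Proof.
move=> freeM; rewrite -row_free_unit -kermx_eq0; apply/eqP.
(* With [K] the kernel of the Gram matrix, [(K *m M) *m (K *m M)^T = 0] forces [K *m M = 0], and the
   free rows of [M] cancel. *)
apply: (row_free_inj freeM); rewrite mul0mx; apply: trmx_sqr_eq0.
by rewrite trmx_mul mulmxA -(mulmxA _ M) mulmx_ker mul0mx.
Qed.

Lemma trmx_null_proj (R : realType) (p q : nat) (M : 'M[R]_(p, q)) :
  (null_proj M)^T = null_proj M.
Proof.
rewrite /null_proj /right_pinv linearB /= trmx1 !trmx_mul trmxK trmx_inv.
by rewrite trmx_mul trmxK mulmxA.
Qed.

Lemma mulmx_null_proj (R : realType) (p q : nat) (M : 'M[R]_(p, q)) :
  row_free M -> M *m null_proj M = 0.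
Proof.
move=> freeM; rewrite /null_proj mulmxBr mulmx1 /right_pinv !mulmxA.
by rewrite mulmxV ?gram_unitmx// mul1mx subrr.
Qed.

(** By symmetry of the projection, the hypothesis transposes to [null_proj M *m N^T = 0], and [N^T]
    is the left factor of [right_pinv N]. *)
Lemma null_proj_mul (R : realType) (p q r : nat)
    (M : 'M[R]_(p, q)) (N : 'M[R]_(r, q)) :
  N *m null_proj M = 0 -> null_proj M *m null_proj N = null_proj M.
Proof.
move=> NM0; have MN0 : null_proj M *m N^T = 0.
  by rewrite -[LHS]trmxK trmx_mul trmxK trmx_null_proj NM0 trmx0.
rewrite {2}/null_proj mulmxBr mulmx1 /right_pinv !mulmxA MN0.
by rewrite !mul0mx subr0.
Qed.

(* No differentiability is assumed: where [f] is not differentiable, the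
   library sets ['d f x] to the zero map. *)
Lemma diff_invariant (R : realType) (V W : normedModType R) (f : V -> W)
    (x v : V) :
  (forall t : R, f (x + t *: v) = f x) -> 'd f x v = 0.
Proof.
move=> fv; have [df|ndf] := pselect (differentiable f x).
  (* The differential at [v] is a directional derivative, whose difference quotient is constantly
     zero. *)
  rewrite -deriveE// /derive.
  under eq_fun do rewrite /= [_ + x]addrC fv subrr scaler0.
  exact: lim_cst.
suff -> : 'd f x = point by [].
(* A member of the set defining the differential would make [f] differentiable, so only the default
   remains. *)
rewrite /diff; case: xgetP => [g gE fg|//]; case: ndf; apply/diffP.
by rewrite /diff -gE.
Qed.

(** By linearity, entry [(i, j)] of the product is the differential along [N^T *m delta_mx i j], a
    direction in which [f] is constant. *)
Lemma mulmx_gradient (R : realType) (p m n : nat) (f : 'M[R]_(m, n) -> R)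
    (N : 'M[R]_(p, m)) (G : 'M[R]_(m, n)) :
  (forall (C : 'M[R]_(p, n)) (t : R), f (G + t *: (N^T *m C)) = f G) ->
  N *m gradient f G = 0.
Proof.
move=> fN; apply/matrixP => i j; rewrite [RHS]mxE mxE.
rewrite -[RHS](@diff_invariant _ _ R^o f G (N^T *m delta_mx i j))//.
have -> : N^T *m delta_mx i j = \sum_k N i k *: delta_mx k j :> 'M[R]_(m, n).
  apply/matrixP => a b; rewrite mxE summxE (bigD1 i)//= big1 => [|k ki].
    rewrite (bigD1 a)//= big1 => [|k ka]; last first.
      by rewrite !mxE eq_sym (negbTE ka) mulr0.
    by rewrite !mxE !eqxx !addr0.
  by rewrite !mxE (negbTE ki) mulr0.
by rewrite linear_sum; apply: eq_bigr => k _; rewrite linearZ mxE.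
Qed.

Section CostInvariance.
Variables (R : realType) (n m T : nat) (A : 'M[R]_n) (B : 'M[R]_(n, m)).
Variables (Q : 'M[R]_n) (Rw : 'M[R]_m).
Variables (Um : 'M[R]_(m, T)) (Xm Xp : 'M[R]_(n, T)).
Hypothesis Xp_dynamics : Xp = A *m Xm + B *m Um.

Lemma lqr_cost_data (G H : 'M[R]_(T, n)) :
  data_matrix Um Xm *m G = data_matrix Um Xm *m H ->
  lqr_cost Q Rw Um Xp G = lqr_cost Q Rw Um Xp H.
Proof.
rewrite !mul_col_mx => /eq_col_mx[UGH XGH].
have XpGH : Xp *m G = Xp *m H.
  by rewrite Xp_dynamics !mulmxDl -!mulmxA UGH XGH.
(* [G] enters the Lyapunov equation only through [Xp *m G], so both solution sets coincide and
   [xget] picks the same element. *)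
have SGH : Sigma Xp G = Sigma Xp H.
  rewrite /Sigma; congr xget; apply/funext => S /=.
  by rewrite -!(mulmxA _ _^T) -!trmx_mul XpGH.
by rewrite /lqr_cost SGH -!trmx_mul -!(mulmxA _ Um) UGH.
Qed.

Lemma null_proj_gradient (G : 'M[R]_(T, n)) : row_free (data_matrix Um Xm) ->
  null_proj (data_matrix Um Xm) *m gradient (lqr_cost Q Rw Um Xp) G = 0.
Proof.
move=> freeD; apply: mulmx_gradient => C t; apply: lqr_cost_data.
rewrite trmx_null_proj mulmxDr -scalemxAr mulmxA mulmx_null_proj//.
by rewrite mul0mx scaler0 addr0.
Qed.

End CostInvariance.

Theorem theorem2 (R : realType) (n m T : nat)
  (A : 'M[R]_n) (B : 'M[R]_(n, m))
  (Q : 'M[R]_n) (Rw : 'M[R]_m)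
  (Um : 'M[R]_(m, T)) (Xm Xp : 'M[R]_(n, T))
  (eta lambda : R) (G : nat -> 'M[R]_(T, n))
  (hAB : controllable A B)
  (hQ : posdefmx Q) (hRw : posdefmx Rw)
  (hdata : Xp = A *m Xm + B *m Um)
  (hrank : row_free (data_matrix Um Xm))
  (heta : 0 <= eta) (hlambda : lambda = 0)
  (hG0 : feasible Xm Xp (G 0%N))
  (hPi0 : null_proj (data_matrix Um Xm) *m G 0%N = 0)
  (hstep : forall k : nat,
     G k.+1 = G k - eta *: (null_proj Xm *m
       gradient (lqr_cost_reg Q Rw Um Xm Xp lambda) (G k)))
  (hfeas : forall k : nat, feasible Xm Xp (G k)) :
  forall k : nat, null_proj (data_matrix Um Xm) *m G k = 0.
Proof.
set D := data_matrix Um Xm in hPi0 *.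
(* [Xm] is the lower block of [D], so the null space of [D] lies in that of [Xm]. *)
have XD0 : Xm *m null_proj D = 0.
  have := mulmx_null_proj hrank; rewrite -/D {1}/D mul_col_mx -col_mx0.
  by case/eq_col_mx.
(* An equality of functions, so that it rewrites under [gradient]. *)
have costE : lqr_cost_reg Q Rw Um Xm Xp lambda = lqr_cost Q Rw Um Xp.
  by apply/funext => H; rewrite /lqr_cost_reg hlambda mul0r addr0.
elim=> [//|k IHk]; rewrite hstep mulmxBr IHk -scalemxAr mulmxA.
by rewrite (null_proj_mul XD0) costE (null_proj_gradient _ _ hdata)// scaler0 subrr.
Qed.
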